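(* Let $f$, $g$, $q=f+g$ be as in the context and suppose that: (a) $q$ is bounded from below on $\operatorname{dom} g$; (b) $g$ is bounded from below by an affine function; (c) $\nabla f:\mathbb X\to\mathbb X$ is locally Lipschitz continuous. Let $\{x^k\}_{k\in\mathbb N}$ be any sequence generated by the nonmonotone proximal gradient method with average line search described in the context, and let $\bar x$ be an accumulation point of $\{x^k\}_{k\in\mathbb N}$. Suppose that $q$ has the KL property at $\bar x$. Then the entire sequence $\{x^k\}_{k\in\mathbb N}$ converges to $\bar x$.
   Context: $\mathbb X$ is a Euclidean space (real finite-dimensional Hilbert space) with inner product $\langle\cdot,\cdot\rangle$ and norm $\|\cdot\|$. $f:\mathbb X\to\mathbb R$ is continuously differentiable, $g:\mathbb X\to\mathbb R\cup\{+\infty\}$ is lower semicontinuous, $q:=f+g$, and $\operatorname{dom} h:=\{x: h(x)<\infty\}$. Nonmonotone proximal gradient method with average line search. Parameters: $\tau>1$, $0<\gamma_{\min}\le\gamma_{\max}<\infty$, $\delta\in(0,1)$, $\frac45<p_{\min}\le 1$, a starting point $x^0\in\operatorname{dom} q$, and a sequence $\{p_k\}$ with $p_k\in[p_{\min},1]$. Set $\Phi_0:=q(x^0)$. For $k=0,1,2,\dots$: choose $\gamma_k^0\in[\gamma_{\min},\gamma_{\max}]$; for $i=0,1,2,\dots$ compute a (global) solution $x^{k,i}$ of $$\min_{x\in\mathbb X}\ f(x^k)+\langle\nabla f(x^k),x-x^k\rangle+\frac{\gamma_{k,i}}{2}\|x-x^k\|^2+g(x),\qquad \gamma_{k,i}:=\tau^i\gamma_k^0,$$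 until $q(x^{k,i})\le\Phi_k-\delta\frac{\gamma_{k,i}}{2}\|x^{k,i}-x^k\|^2$ holds. Let $i_k$ be the terminal value of $i$ (the first index at which this holds), set $\gamma_k:=\gamma_{k,i_k}$, $x^{k+1}:=x^{k,i_k}$, and $\Phi_{k+1}:=(1-p_k)\Phi_k+p_kq(x^{k+1})$. The method is assumed to run without terminating, so that it generates an infinite sequence. Subdifferentials. For lower semicontinuous $h:\mathbb X\to\mathbb R\cup\{+\infty\}$ and $x\in\operatorname{dom} h$, the regular subdifferential is $\widehat\partial h(x):=\{\eta: \liminf_{y\to x,\,y\ne x}\frac{h(y)-h(x)-\langle\eta,y-x\rangle}{\|y-x\|}\ge0\}$, and the limiting subdifferential $\partial h(x)$ is the set of all $\eta$ for which there are $x^j\to x$ with $h(x^j)\to h(x)$ and $\eta^j\to\eta$ with $\eta^j\in\widehat\partial h(x^j)$ for all $j$. $\operatorname{dist}(x,A):=\inf\{\|y-x\|: y\in A\}$, with $\operatorname{dist}(x,\emptyset):=\infty$. KL property. A lower semicontinuous $h$ has the KL property at $x^*\in\{x:\partial h(x)\ne\emptyset\}$ if there exist $\eta>0$, a neighborhood $U$ of $x^*$, and a continuous concave function $\chi:[0,\eta]\to[0,\infty)$, continuously differentiable on $(0,\eta)$, with $\chi(0)=0$ and $\chi'(t)>0$ for $t\in(0,\eta)$, such that $\chi'(h(x)-h(x^* ))\operatorname{dist}(0,\partial h(x))\ge1$ for all $x\in U$ with $h(x^* )<h(x)<h(x^* )+\eta$. *)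

(* Defs.v *)
From HB Require Import structures.
From mathcomp Require Import all_boot all_order all_algebra sesquilinear.
From mathcomp Require Import all_classical all_reals all_analysis.

Set Implicit Arguments.
Unset Strict Implicit.
Unset Printing Implicit Defensive.

Import Order.TTheory GRing.Theory Num.Theory.
Import numFieldNormedType.Exports.

Local Open Scope classical_set_scope.
Local Open Scope ring_scope.

(* Finite dimension comes from the vectType structure; the norm (hence the
   topology) of the normedModType structure is the one induced by the inner
   product. *)
HB.mixin Record isEuclidean (R : realType) X
    of NormedModule R X & Vector R X := {
  inner : {dot X for @idfun R} ;
  inner_norm : forall x : X, inner x x = `|x| ^+ 2
}.

#[short(type="euclideanType")]
HB.structure Definition Euclidean (R : realType) :=
  { X of isEuclidean R X & NormedModule R X & Vector R X }.

Notation "''[' u , v ]" := (inner u v) (format "''[' u ,  v ]") : ring_scope.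

Section nonsmooth_analysis.
Context {R : realType} {X : euclideanType R}.
Implicit Types (f : X -> R) (g h : X -> \bar R) (x : X).

(* For f differentiable at x, the vector representing 'd f x. *)
Definition gradient f x : X := get [set v : X | forall u, 'd f x u = '[v, u]].

Definition continuously_differentiable f :=
  (forall x, differentiable f x) /\ continuous (gradient f).

Definition locally_lipschitz (F : X -> X) :=
  forall x, exists2 U : set X, nbhs x U & [lipschitz F y | y in U].

Definition dom h : set X := [set x | (h x < +oo)%E].

Definition dist x (A : set X) : \bar R :=
  ereal_inf [set `|y - x|%:E | y in A].

Definition regular_subdifferential h x : set X :=
  [set v | dom h x /\
    (0 <= limf_einf
      (fun y => (h y - h x - '[v, y - x]%:E) * (`|y - x|^-1)%:E) x^')%E].

Definition limiting_subdifferential h x : set X :=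
  [set v | dom h x /\
    exists (xs vs : nat -> X),
      [/\ xs @ \oo --> x, h (xs j) @[j --> \oo] --> h x, vs @ \oo --> v
        & forall j, regular_subdifferential h (xs j) (vs j)]].

(* chi is only constrained on [0, eta]; concavity is convexity of - chi. *)
Definition desingularizing (eta : R) (chi : R -> R) :=
  [/\ {within `[0, eta], continuous chi},
      convex_function (`[0, eta] : set R^o) (fun t : R^o => - chi t),
      (forall t, t \in `[0, eta] -> 0 <= chi t),
      chi 0 = 0 &
      forall t, t \in `]0, eta[ ->
        [/\ derivable chi t 1, {for t, continuous (derive1 chi)}
          & 0 < derive1 chi t]].

(* The nonemptiness of the limiting subdifferential at xs makes h xs finite,
   so that fine is applied to a real number below. *)
Definition KL_property h (xs : X) :=
  limiting_subdifferential h xs !=set0 /\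
  exists (eta : R) (U : set X) (chi : R -> R),
    [/\ 0 < eta, nbhs xs U, desingularizing eta chi &
      forall x, U x -> (h xs < h x < h xs + eta%:E)%E ->
        (1 <= (derive1 chi (fine (h x - h xs)))%:E
              * dist 0%R (limiting_subdifferential h x))%E].

End nonsmooth_analysis.

Section proximal_gradient.
Context {R : realType} {X : euclideanType R}.
Variables (f : X -> R) (g : X -> \bar R).

Definition objective (x : X) : \bar R := ((f x)%:E + g x)%E.

Definition prox_model (c : X) (gamma : R) (x : X) : \bar R :=
  ((f c + '[gradient f c, x - c] + gamma / 2 * `|x - c| ^+ 2)%:E + g x)%E.

Definition prox_solution (c : X) (gamma : R) (x : X) :=
  forall y, (prox_model c gamma x <= prox_model c gamma y)%E.

Fixpoint average_value (p : nat -> R) (x : nat -> X) (k : nat) : \bar R :=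
  if k is k'.+1 then
    ((1 - p k')%:E * average_value p x k' + (p k')%:E * objective (x k))%E
  else objective (x 0%N).

Definition sufficient_decrease (delta : R) (Phi : \bar R) (gamma : R)
    (c x : X) :=
  (objective x <= Phi - (delta * (gamma / 2) * `|x - c| ^+ 2)%:E)%E.

(* gamma0 k is the initial stepsize, trial k i the i-th trial point and ik k
   the terminal index of the k-th line search. The values of trial k i for
   i > ik k are irrelevant. *)
Definition prox_gradient_sequence (tau gamma_min gamma_max delta : R)
    (p : nat -> R) (x : nat -> X) :=
  dom objective (x 0%N) /\
  exists (gamma0 : nat -> R) (trial : nat -> nat -> X) (ik : nat -> nat),
    forall k,
      let gamma i := tau ^+ i * gamma0 k in
      let accepted i := sufficient_decrease delta (average_value p x k)
                          (gamma i) (x k) (trial k i) in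
      [/\ gamma_min <= gamma0 k <= gamma_max,
          (forall i, (i <= ik k)%N -> prox_solution (x k) (gamma i) (trial k i)),
          (forall i, (i < ik k)%N -> ~ accepted i),
          accepted (ik k)
        & x k.+1 = trial k (ik k)].

End proximal_gradient.

(* Main.v *)
(* The averaged values [Phi_k] dominate [q(x^k)] and decrease by at least a
   multiple of [|x^{k+1} - x^k|^2], so both converge to one limit, the steps
   tend to 0, and near [xbar] the stepsizes stay bounded; hence the limit is
   [q(xbar)]. With [D_k := Phi_k - Phi_{k+1}] and [a_k := Phi_k - q(xbar)] one
   has [D_{k+1} = (q(x^{k+1}) - Phi_{k+2}) + (1/p_k - 1) D_k], where
   [1/p_k - 1 < 1/4]. If the first summand is positive, then [x^{k+1}] is above
   the limiting value, and the KL inequality there together with the concavity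
   of [chi] bounds it by [C sqrt(D_k) (chi(a_{k+1}) - chi(a_{k+2}))]. Completing
   the square,
   [sqrt(D_{k+1}) <= sqrt(D_k) / 2 + C (chi(a_{k+1}) - chi(a_{k+2}))]
   as long as the iterates stay near [xbar]. Summing shows that they do, in an
   arbitrarily small ball. *)
Require Import Defs.
From HB Require Import structures.
From mathcomp Require Import all_boot all_order all_algebra sesquilinear.
From mathcomp Require Import all_classical all_reals all_analysis.
From mathcomp Require Import ring lra.

Set Implicit Arguments.
Unset Strict Implicit.
Unset Printing Implicit Defensive.

Import Order.TTheory GRing.Theory Num.Theory.
Import numFieldNormedType.Exports.

Local Open Scope classical_set_scope.
Local Open Scope ring_scope.

(** * Inner product, gradients and first-order remainder estimates *)

Section euclidean.
Context {R : realType} {X : euclideanType R}.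
Implicit Types (u v w x y z : X) (f : X -> R).

Lemma innerDl u v w : '[u + v, w] = '[u, w] + '[v, w].
Proof. exact: linearDl. Qed.

Lemma innerBl u v w : '[u - v, w] = '[u, w] - '[v, w].
Proof. exact: linearBl. Qed.

Lemma innerNl u w : '[- u, w] = - '[u, w].
Proof. exact: linearNl. Qed.

Lemma innerZl a u w : '[a *: u, w] = a * '[u, w].
Proof. exact: linearZl_LR. Qed.

Lemma innerC u v : '[u, v] = '[v, u].
Proof. by rewrite hermC/= expr0 mul1r. Qed.

Lemma innerDr u v w : '[w, u + v] = '[w, u] + '[w, v].
Proof. by rewrite innerC innerDl !(innerC w). Qed.

Lemma innerBr u v w : '[w, u - v] = '[w, u] - '[w, v].
Proof. by rewrite innerC innerBl !(innerC w). Qed.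

Lemma innerNr u w : '[w, - u] = - '[w, u].
Proof. by rewrite innerC innerNl (innerC w). Qed.

Lemma innerZr a u w : '[w, a *: u] = a * '[w, u].
Proof. by rewrite innerC innerZl (innerC w). Qed.

Lemma inner0 u : '[u, 0] = 0.
Proof. by rewrite -(subrr u) innerBr subrr. Qed.

Lemma normD_sqr u v : `|u + v| ^+ 2 = `|u| ^+ 2 + 2 * '[u, v] + `|v| ^+ 2.
Proof.
rewrite -!inner_norm innerDl !innerDr (innerC v u); lra.
Qed.

Lemma inner_le_norm u v : `|'[u, v]| <= `|u| * `|v|.
Proof.
have [->|v0] := eqVneq v 0; first by rewrite inner0 normr0 normr0 mulr0.
have v_gt0 : 0 < `|v| by rewrite normr_gt0.
rewrite -(@ler_pXn2r _ 2%N) ?nnegrE ?mulr_ge0// exprMn.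
rewrite real_normK ?num_real//.
(* This vector is the component of [u] orthogonal to [v], scaled by [|v|^2] to avoid a division. *)
have := sqr_ge0 `|(`|v| ^+ 2) *: u - '[u, v] *: v|.
rewrite normD_sqr -scaleNr !normrZ innerZl innerZr !exprMn.
rewrite !real_normK ?num_real// sqrrN.
have := exprn_gt0 2 v_gt0.
set N := `|v| ^+ 2; set M := `|u| ^+ 2; set I := '[u, v] => N0 H.
rewrite -(@ler_pM2l _ N)//; lra.
Qed.

Definition inner_form v : X -> R^o := inner v.

Fact inner_form_linear v : linear (inner_form v).
Proof. by move=> a u w; rewrite /inner_form innerDr innerZr. Qed.

HB.instance Definition _ v :=
  GRing.isLinear.Build R X R^o _ (inner_form v) (inner_form_linear v).

(** The map sending [v] to the form ['[v, _]] is injective into a dual of the same dimension, hence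
    onto. *)
Lemma riesz (phi : {linear X -> R^o}) : exists v, forall u, phi u = '[v, u].
Proof.
pose F v : 'Hom(X, R^o) := linfun (inner_form v).
have Flin : linear F.
  move=> a u v; apply/lfunP => w.
  rewrite add_lfunE scale_lfunE !lfunE/=.
  by rewrite /inner_form innerDl innerZl.
pose F' : {linear X -> 'Hom(X, R^o)} :=
  HB.pack F (GRing.isLinear.Build R X _ _ F Flin).
have FE v w : linfun F' v w = '[v, w] by rewrite lfunE/= lfunE.
have ker0 : lker (linfun F') == 0%VS.
  apply/lker0P => u v uv; apply/eqP; rewrite -subr_eq0 -normr_eq0 -sqrf_eq0.
  by rewrite -inner_norm innerBl -!FE uv subrr.
have full : limg (linfun F') = fullv.
  apply/eqP; rewrite eqEdim subvf limg_dim_eq ?(eqP ker0) ?capv0//=.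
  by rewrite !dimvf /dim/= muln1.
have : linfun phi \in limg (linfun F') by rewrite full memvf.
case/memv_imgP => v _ phiE; exists v => u.
by rewrite -FE -phiE lfunE.
Qed.

(** By [riesz] the set in [gradient] is nonempty, so [get] returns a member of it and not a default
    value. *)
Lemma gradientE f x u : 'd f x u = '[gradient f x, u].
Proof.
have [v vE] := riesz ('d f x : {linear X -> R^o}).
by apply: (@getPex _ [set v : X | forall u, 'd f x u = '[v, u]]); exists v.
Qed.

Lemma derive_along_line f x v (t : R) : (forall y, differentiable f y) ->
  is_derive t 1 (fun s : R => f (x + s *: v)) '[gradient f (x + t *: v), v].
Proof.
move=> df; set y := x + t *: v.
have quotE : (fun h : R => h^-1 *: ((fun s : R => f (x + s *: v)) (h *: 1 + t)
                - (fun s : R => f (x + s *: v)) t)) =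
             (fun h : R => h^-1 *: ((f \o shift y) (h *: v) - f y)).
  apply/funext => h /=; congr (_ *: (f _ - _)).
  by rewrite /y [h *: 1]mulr1 scalerDl addrCA.
have dv : derivable f y v := diff_derivable (df y).
apply: DeriveDef; first by move: dv; rewrite /derivable -quotE.
by rewrite -gradientE -deriveE// /derive /= quotE.
Qed.

Lemma mean_value f x y : (forall z, differentiable f z) ->
  exists2 t : R, 0 < t < 1 &
    f y - f x = '[gradient f (x + t *: (y - x)), y - x].
Proof.
move=> df; have dg t := derive_along_line x (y - x) t df.
have [|t + E] := @MVT R _ (fun t => '[gradient f (x + t *: (y - x)), y - x]) 0 1
    ltr01 (fun t _ => dg t).
  apply: continuous_subspaceT => t.
  by apply: differentiable_continuous; apply/derivable1_diffP; exact: ex_derive.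
rewrite in_itv/= => t01; exists t => //.
by move: E; rewrite scale1r scale0r addr0 subr0 mulr1 (addrC x) subrK.
Qed.

Lemma locally_lipschitz_ball (F : X -> X) z : locally_lipschitz F ->
  exists r L : R, [/\ 0 < r, 0 <= L &
    forall x y, `|x - z| < r -> `|y - z| < r -> `|F x - F y| <= L * `|x - y|].
Proof.
move=> /(_ z)[U /nbhs_ballP[r /= r0 rU] [M [_ FM]]].
(* The Lipschitz bound holds for every constant above [M]; this one is also nonnegative. *)
exists r, (`|M| + 1); split => // x y xr yr.
apply: (FM (`|M| + 1) _ (x, y)) => /=.
  by rewrite (le_lt_trans (ler_norm _))// ltrDl.
by split; apply: rU; rewrite /= -ball_normE/= distrC.
Qed.

Lemma segment_ball x y z (r t : R) : `|x - z| < r -> `|y - z| < r ->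
  0 < t < 1 -> `|x + t *: (y - x) - z| < r.
Proof.
move=> xr yr /andP[t0 t1].
have -> : x + t *: (y - x) - z = (1 - t) *: (x - z) + t *: (y - z).
  have -> : y - x = (y - z) - (x - z) by rewrite opprB addrA subrK.
  by rewrite scalerBr scalerBl scale1r addrAC addrA addrAC -addrA addrC addrAC.
rewrite (le_lt_trans (ler_normD _ _))// !normrZ !ger0_norm ?subr_ge0 ?ltW//.
nra.
Qed.

(** By the mean value theorem the remainder is the inner product of a gradient difference with
    [y - x]. This gives the constant [L] instead of the sharp [L / 2], which is enough below. *)
Lemma gradient_remainder f z (r L : R) : (forall y, differentiable f y) ->
  (forall x y, `|x - z| < r -> `|y - z| < r ->
    `|gradient f x - gradient f y| <= L * `|x - y|) ->
  forall x y, `|x - z| < r -> `|y - z| < r ->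
    `|f y - f x - '[gradient f x, y - x]| <= L * `|y - x| ^+ 2.
Proof.
move=> df gradL x y xr yr.
have [t t01 ->] := mean_value x y df.
have wr := segment_ball xr yr t01.
rewrite -innerBl (le_trans (inner_le_norm _ _))// expr2 mulrA.
rewrite ler_wpM2r// (le_trans (gradL _ _ wr xr))//.
have L0 : 0 <= L * `|y - x| by rewrite (le_trans _ (gradL _ _ yr xr)).
rewrite addrC addKr normrZ mulrCA ler_piMl//.
by have /andP[/ltW t0 /ltW] := t01; rewrite ger0_norm.
Qed.

End euclidean.

(** * Tangents, monotonicity and the limit at 0 of desingularizing functions *)

Section desingularizing.
Context {R : realType}.
Variables (eta : R) (chi : R -> R).
Hypothesis chiP : desingularizing eta chi.

Lemma desingularizing_tangent (s t : R) : 0 <= s <= eta -> 0 < t < eta ->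
  chi s <= chi t + derive1 chi t * (s - t).
Proof.
case: chiP => _ chi_convex _ _ chi_diff s_in t_in.
have [dchi _ _] := chi_diff t t_in.
have [->|st] := eqVneq s t; first by rewrite subrr mulr0 addr0.
rewrite leNgt; apply/negP => lt_chi.
have st0 : 0 < `|s - t| by rewrite normr_gt0 subr_eq0.
(* The excess over the tangent per unit length serves as the accuracy of the difference quotient at
   [t]. By concavity the excess persists, in proportion, at points [w] between [t] and [s], which
   contradicts that accuracy for [w] close to [t]. *)
pose d := (chi s - (chi t + derive1 chi t * (s - t))) / `|s - t|.
have d0 : 0 < d by rewrite divr_gt0// subr_gt0.
have /cvgrPdist_lt/(_ d d0) := dchi.
case/nbhs_ballP => r /= r0 quot.
pose l := Num.min 1 (r / 2 / `|s - t|).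
have l0 : 0 < l by rewrite lt_min ltr01 !divr_gt0.
have l1 : l <= 1 by rewrite ge_min lexx.
have h0 : l * (s - t) != 0 by rewrite mulf_neq0 ?subr_eq0// gt_eqF.
have hr : `|l * (s - t)| < r.
  rewrite normrM gtr0_norm// (@le_lt_trans _ _ (r / 2))//.
    by rewrite -ler_pdivlMr// ge_min lexx orbT.
  by rewrite ltr_pdivrMr// ltr_pMr// ltr1n.
pose w := l * s + (1 - l) * t.
have hw : l * (s - t) *: 1 + t = w by rewrite /w [_ *: 1]mulr1; lra.
have := quot (l * (s - t)); rewrite -ball_normE/= sub0r normrN => /(_ hr h0).
rewrite -[lim _]/(derive chi t 1) -derive1E hw => quot_w.
have : `|derive1 chi t * (l * (s - t)) - (chi w - chi t)| <
    l * (chi s - (chi t + derive1 chi t * (s - t))).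
  have -> : l * (chi s - (chi t + derive1 chi t * (s - t))) =
      d * `|l * (s - t)|.
    by rewrite normrM (gtr0_norm l0) mulrCA divfK// gt_eqF.
  rewrite -ltr_pdivrMr ?normr_gt0// -normf_div mulrBl mulfK//.
  by rewrite [_ / (l * (s - t))]mulrC.
have chi_w : l * chi s + (1 - l) * chi t <= chi w.
  have := chi_convex (Itv01 (ltW l0) l1) s t.
  rewrite !inE/= !in_itv/= s_in => /(_ isT).
  have -> : 0 <= t <= eta by have /andP[/ltW-> /ltW] := t_in.
  move=> /(_ isT).
  rewrite -[_ <= _]/(- chi w <= l * - chi s + (1 - l) * - chi t); lra.
rewrite ltr_norml => /andP[]; lra.
Qed.

(** The tangent is taken at the larger point, since [chi] need not be differentiable at [s = 0]. *)
Lemma desingularizing_le (s t : R) : 0 <= s -> s <= t -> t < eta ->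
  chi s <= chi t.
Proof.
move=> s0 st teta.
have [->//|neq_st] := eqVneq s t.
have t0 : 0 < t by rewrite (le_lt_trans s0)// lt_neqAle neq_st.
have t_in : 0 < t < eta by rewrite t0.
have s_in : 0 <= s <= eta by rewrite s0 (le_trans st)// ltW.
have := desingularizing_tangent s_in t_in.
case: chiP => _ _ _ _ /(_ t t_in)[_ _ dchi0]; nra.
Qed.

Lemma desingularizing_cvg0 (u : nat -> R) : 0 < eta ->
  (forall k, 0 <= u k) -> u @ \oo --> 0 -> chi (u k) @[k --> \oo] --> 0.
Proof.
move=> eta0 u_ge0 u0; case: chiP => chi_cont _ _ chi0 _.
have [_ + _] := (continuous_within_itvP chi eta0).1 chi_cont.
rewrite chi0 => /cvgrPdist_lt chi_lim.
apply/cvgrPdist_lt => e e0.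
have [r /= r0 chi_r] := chi_lim e e0.
have u_lt : \forall k \near \oo, u k < r by exact: (cvgr_lt 0 u0).
apply: filterS u_lt => k uk.
(* The right-hand limit at 0 says nothing about the point 0 itself. *)
have [->|uk0] := eqVneq (u k) 0; first by rewrite chi0 subrr normr0.
apply: chi_r; last by rewrite lt_neqAle eq_sym uk0 u_ge0.
by rewrite /= sub0r normrN ger0_norm.
Qed.

End desingularizing.

(* The potential [|x k - z| + 2 c s_k + 2 c C phi_{k+1}] is nonincreasing as
   long as the iterates stay in the ball, so they never leave it. *)
Lemma trapped_in_ball (R : realType) (X : normedModType R)
    (x : nat -> X) (z : X) (s phi : nat -> R) (c C e : R) (K : nat) :
  0 <= c -> 0 <= C -> (forall k, 0 <= s k) ->
  (forall k, (K <= k)%N -> 0 <= phi k) ->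
  (forall k, `|x k.+1 - x k| <= c * s k) ->
  (forall k, (K <= k)%N -> `|x k - z| < e -> `|x k.+1 - z| < e ->
     s k.+1 <= s k / 2 + C * (phi k.+1 - phi k.+2)) ->
  `|x K - z| + 2 * c * s K + 2 * c * C * phi K.+1 < e ->
  forall k, (K <= k)%N -> `|x k - z| < e.
Proof.
move=> c0 C0 s0 phi0 step rec VK.
have cs k : 0 <= c * s k by rewrite mulr_ge0.
have cphi k : (K <= k)%N -> 0 <= c * C * phi k.
  by move=> Kk; rewrite !mulr_ge0// phi0.
(* [rec] needs two consecutive iterates in the ball; the term [2 * c * s k] also pays for the next
   step. *)
have in_ball k : (K <= k)%N ->
    `|x k - z| + 2 * c * s k + 2 * c * C * phi k.+1 < e ->
    `|x k - z| < e /\ `|x k.+1 - z| < e.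
  move=> Kk Vk; have := cs k; have := cphi k.+1 (leqW Kk) => phik sk.
  split; first lra.
  have -> : x k.+1 - z = (x k.+1 - x k) + (x k - z) by rewrite addrA subrK.
  by rewrite (le_lt_trans (ler_normD _ _))//; have := step k; lra.
suff V k : (K <= k)%N ->
    `|x k - z| + 2 * c * s k + 2 * c * C * phi k.+1 < e.
  by move=> k Kk; have [] := in_ball k Kk (V k Kk).
elim: k => [|k IH]; first by rewrite leqn0 => /eqP K0; move: VK; rewrite K0.
rewrite leq_eqVlt => /predU1P[<-//|]; rewrite ltnS => Kk.
have [xk xk1] := in_ball k Kk (IH Kk).
(* Doubled, the recursion times [c] contributes [c * s k], and so does the step; together they use
   up the old [2 * c * s k]. *)
have := rec k Kk xk xk1; move=> /(ler_wpM2l c0); have := step k; have := IH Kk.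
have : `|x k.+1 - z| <= `|x k.+1 - x k| + `|x k - z|.
  by rewrite (le_trans _ (ler_normD _ _))// addrA subrK.
lra.
Qed.

(** * Optimality of proximal points *)

Section prox_step.
Context {R : realType} {X : euclideanType R}.
Variables (f : X -> R) (g : X -> \bar R).
Implicit Types (c x y z : X).

Lemma objective_fin y (r : R) : objective f g y = r%:E -> g y = (r - f y)%:E.
Proof.
rewrite /objective; case: (g y) => [s [<-]| |]//=.
by rewrite addrAC subrr add0r.
Qed.

(** Comparison with a point of finite objective forces [g z] to be finite. The differences [s - f z]
    and [r - f y] stand for [g z] and [g y], so that later steps are real arithmetic. *)
Lemma prox_solution_le c z y (gamma r : R) : g z != -oo%E ->
  prox_solution f g c gamma z -> objective f g y = r%:E ->
  exists2 s : R, objective f g z = s%:E &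
    s - f z + gamma / 2 * (`|z - c| ^+ 2 - `|y - c| ^+ 2)
      <= r - f y + '[gradient f c, y - z].
Proof.
move=> gz /(_ y) + /objective_fin gy; rewrite /prox_model /objective gy.
case: (g z) gz => [s _| |]//=; rewrite -EFinD lee_fin => zy.
exists (f z + s) => //.
have -> : y - z = (y - c) - (z - c) by rewrite opprB addrA subrK.
rewrite innerBr; lra.
Qed.

Hypothesis f_diff : forall x, differentiable f x.
Hypothesis grad_lip : locally_lipschitz (gradient f).

(** Fermat's rule for the proximal problem: with $v$ the claimed subgradient, minimality and the
    remainder bound on $f$ give $q(y) - q(z) - \langle v, y - z\rangle \ge -C\|y - z\|^2$, which is
    $o(\|y - z\|)$. *)
Lemma prox_solution_regular_subdifferential c z (gamma s : R) :
  (forall y, g y != -oo%E) -> prox_solution f g c gamma z ->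
  objective f g z = s%:E ->
  regular_subdifferential (objective f g) z
    (gradient f z - gradient f c - gamma *: (z - c)).
Proof.
move=> gNy zP qz; set v := _ - _ *: _; split; first by rewrite /dom/= qz ltry.
rewrite limf_einfE; apply/lee_addgt0Pr => e e0.
have [r [L [r0 L0 gradL]]] := locally_lipschitz_ball z grad_lip.
pose C := L + `|gamma| / 2.
have C0 : 0 <= C by rewrite addr_ge0// divr_ge0.
(* Within [e / (C + 1)] of [z] the quadratic error is at most [e * |y - z|]; the added 1 covers
   [C = 0]. *)
pose d := Num.min r (e / (C + 1)).
have d0 : 0 < d by rewrite lt_min r0 divr_gt0// ltr_wpDl.
rewrite -leeBlDr//; rewrite sub0e.
(* The limit inferior is a supremum of infima; the punctured ball of radius [d] is the witness. *)
apply: le_ereal_sup_tmp.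
eexists.
  exists [set y | `|y - z| < d /\ y != z].
    by apply/nbhs_ballP; exists d => //= y; rewrite -ball_normE/= distrC.
  by [].
apply: le_ereal_inf_tmp => _ [y [yd yz] <-].
have yz0 : 0 < `|y - z| by rewrite normr_gt0 subr_eq0.
case qyE : (objective f g y) => [t| |]; last 2 first.
- by rewrite qz /= gt0_mulye ?leNye ?leey// lte_fin invr_gt0.
- by move: qyE (gNy y); rewrite /objective; case: (g y).
have [s'] := prox_solution_le (gNy z) zP qyE.
rewrite qz => -[<-] {s'} ineq.
rewrite -!EFinB -EFinM lee_fin ler_pdivlMr//.
have zz : `|z - z| < r by rewrite subrr normr0.
have yr : `|y - z| < r by rewrite (lt_le_trans yd)// ge_min lexx.
have := gradient_remainder f_diff gradL zz yr; rewrite ler_norml => /andP[fy _].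
have yc : `|y - c| ^+ 2 = `|y - z| ^+ 2 + 2 * '[z - c, y - z] + `|z - c| ^+ 2.
  have -> : y - c = (z - c) + (y - z) by rewrite [RHS]addrC subrKA.
  by rewrite normD_sqr; ring.
have vy : '[v, y - z] = '[gradient f z, y - z] - '[gradient f c, y - z]
    - gamma * '[z - c, y - z].
  by rewrite /v (innerBl (_ - _)) (innerBl (gradient f z)) innerZl.
have small : C * `|y - z| ^+ 2 <= e * `|y - z|.
  rewrite expr2 mulrA ler_wpM2r//.
  have : `|y - z| < e / (C + 1) by rewrite (lt_le_trans yd)// ge_min lexx orbT.
  rewrite ltr_pdivlMr ?ltr_wpDl// => /ltW; apply: le_trans.
  by rewrite mulrDr mulr1 mulrC lerDl.
have gN : gamma / 2 * `|y - z| ^+ 2 <= `|gamma| / 2 * `|y - z| ^+ 2.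
  by rewrite ler_wpM2r// ler_wpM2r// ler_norm.
move: ineq small fy gN; rewrite yc vy /C.
move: '[gradient f z, y - z] '[gradient f c, y - z] '[z - c, y - z].
move: (f y) (f z) (`|y - z|) (`|z - c|) (`|gamma|).
by clear; move=> *; lra.
Qed.

End prox_step.

(** * Acceptance of large stepsizes *)

Section stepsizes.
Context {R : realType} {X : euclideanType R}.
Variables (f : X -> R) (g : X -> \bar R).
Implicit Types (c x y z : X).
Hypothesis f_diff : forall x, differentiable f x.
Hypothesis grad_lip : locally_lipschitz (gradient f).

(* For large [gamma] the affine minorant keeps the proximal point close to [c],
   where the quadratic upper bound on [f] holds. *)
Lemma large_stepsize_accepted (a z : X) (b delta phi0 : R) :
  (forall y, ('[a, y] + b)%:E <= g y)%E -> 0 < delta < 1 ->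
  exists r Gamma : R, 0 < r /\
    forall c y (gamma phi : R), `|c - z| < r -> Gamma <= gamma ->
      (objective f g c <= phi%:E)%E -> objective f g c \is a fin_num ->
      phi <= phi0 ->
      prox_solution f g c gamma y ->
      sufficient_decrease f g delta phi%:E gamma c y.
Proof.
move=> ga /andP[delta0 delta1].
have [r0 [L [r0_gt0 L0 gradL]]] := locally_lipschitz_ball z grad_lip.
(* If [c] is within [h] of [z] and [y] within [h] of [c], then [y] is in the ball of radius [r0]. On
   that ball [B] bounds the gradient and [F0] bounds [f] from below. *)
pose h := r0 / 2.
have h0 : 0 < h by rewrite divr_gt0.
pose B := `|gradient f z| + L * r0.
pose F0 := f z - `|gradient f z| * r0 - L * r0 ^+ 2.
pose C0 := `|phi0 - F0 + `|a| * r0 - '[a, z] - b|.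
pose C1 := `|a| + B.
have B0 : 0 <= B by rewrite addr_ge0// mulr_ge0// ltW.
have C10 : 0 <= C1 by rewrite addr_ge0.
(* Minimality will give [gamma / 2 * rho ^+ 2 <= C0 + C1 * rho] for [rho = |y - c|]; dividing by
   [rho ^+ 2], [Gamma1] rules out [rho >= h]. [Gamma2] lets the share [1 - delta] of the quadratic
   term absorb the remainder of [f]. *)
pose Gamma1 := 2 * (C0 / h ^+ 2 + C1 / h) + 1.
pose Gamma2 := 2 * L / (1 - delta).
exists h, (Num.max Gamma1 Gamma2); split => // c y gamma phi cz.
rewrite ge_max => /andP[gamma1 gamma2] qc_phi qc_fin phi_phi0 yP.
have hr0 : h < r0 by rewrite /h; lra.
have cr0 : `|c - z| < r0 by rewrite (lt_trans cz).
have zr0 : `|z - z| < r0 by rewrite subrr normr0.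
move: (fineK qc_fin) qc_phi; move: (fine _) => q /esym qc.
rewrite qc lee_fin => q_phi.
have gy : g y != -oo%E by apply: contraTneq (ga y) => ->.
(* The comparison point is the center [c] itself. *)
have [s qy step] := prox_solution_le gy yP qc.
rewrite /sufficient_decrease qy -EFinB lee_fin.
have fc : F0 <= f c.
  have := gradient_remainder f_diff gradL zr0 cr0.
  have := inner_le_norm (gradient f z) (c - z).
  rewrite !ler_norml => /andP[+ _] /andP[+ _].
  have : `|gradient f z| * `|c - z| <= `|gradient f z| * r0.
    by rewrite ler_wpM2l// ltW.
  have : L * `|c - z| ^+ 2 <= L * r0 ^+ 2.
    by rewrite ler_wpM2l// lerXn2r ?nnegrE// ltW.
  rewrite /F0.
  move: '[_, _] (f c) (f z) (`|c - z|) (`|gradient f z|).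
  by clear; move=> *; lra.
have gradc : `|gradient f c| <= B.
  rewrite -[gradient f c](subrK (gradient f z)) (le_trans (ler_normD _ _))//.
  rewrite addrC lerD2l (le_trans (gradL _ _ cr0 zr0))//.
  by rewrite ler_wpM2l// ltW.
rewrite subrr normr0 expr0n/= subr0 in step.
have gyE := objective_fin qy.
have := ga y; rewrite gyE lee_fin => ga_y.
set rho := `|y - c| in step *.
have rho0 : 0 <= rho by rewrite normr_ge0.
have a_y : - (`|a| * rho) - `|a| * r0 + '[a, z] <= '[a, y].
  have -> : y = (y - c) + (c - z) + z by rewrite subrKA subrK.
  rewrite (innerDr (y - c + (c - z))) (innerDr (y - c)).
  have := inner_le_norm a (y - c); have := inner_le_norm a (c - z).
  rewrite !ler_norml => /andP[+ _] /andP[+ _].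
  have : `|a| * `|c - z| <= `|a| * r0 by rewrite ler_wpM2l// ltW.
  rewrite -/rho.
  move: '[a, y - c] '[a, c - z] '[a, z] (`|c - z|) (`|a|).
  by clear; move=> *; lra.
have grad_cy : '[gradient f c, c - y] = - '[gradient f c, y - c].
  by rewrite -[in LHS]opprB innerNr.
have grad_y : '[gradient f c, c - y] <= B * rho.
  have := inner_le_norm (gradient f c) (c - y).
  rewrite distrC -/rho => /(le_trans (ler_norm _)) /le_trans; apply.
  by rewrite ler_wpM2r.
have model_y : gamma / 2 * rho ^+ 2 <= C0 + C1 * rho.
  have : phi0 - F0 + `|a| * r0 - '[a, z] - b <= C0 by rewrite ler_norm.
  have -> : C1 * rho = `|a| * rho + B * rho by rewrite [LHS]mulrDl.
  move: step a_y grad_y ga_y fc q_phi phi_phi0.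
  move: (`|a| * _) (`|a| * _) '[a, z] '[a, y] (B * rho) '[_, _] (_ * rho ^+ 2).
  by clear; move=> *; lra.
have C00 : 0 <= C0 by rewrite normr_ge0.
clearbody C0 C1.
have rho_h : rho < h.
  rewrite ltNge; apply/negP => h_rho.
  have : gamma <= 2 * (C0 / h ^+ 2 + C1 / h).
    rewrite mulrC -ler_pdivrMr// -(@ler_pM2r _ (rho ^+ 2)); last first.
      by rewrite exprn_gt0// (lt_le_trans h0).
    rewrite (le_trans model_y)// mulrDl lerD//.
      rewrite mulrAC ler_pdivlMr ?exprn_gt0// ler_wpM2l//.
      by rewrite lerXn2r ?nnegrE// ltW.
    by rewrite mulrAC ler_pdivlMr// expr2 [leRHS]mulrA ler_wpM2l// mulr_ge0.
  by rewrite leNgt (lt_le_trans _ gamma1)// ltrDl.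
have yr0 : `|y - z| < r0.
  rewrite -(subrKA c) (le_lt_trans (ler_normD _ _))//.
  have -> : r0 = h + h by rewrite /h -splitr.
  exact: ltrD.
have := gradient_remainder f_diff gradL cr0 yr0.
rewrite ler_norml -/rho => /andP[_ fy].
have L_gamma : L * rho ^+ 2 <= gamma * (1 - delta) / 2 * rho ^+ 2.
  rewrite ler_wpM2r ?exprn_ge0// ler_pdivlMr// mulrC -ler_pdivrMr ?subr_gt0//.
move: step fy L_gamma q_phi; rewrite grad_cy.
move: '[_, _] (f y) (f c) (rho ^+ 2).
by clear; move=> *; lra.
Qed.

End stepsizes.

(** * Passage from extended real to real values along a run *)

Section run_values.
Context {R : realType} {X : euclideanType R}.
Variables (f : X -> R) (g : X -> \bar R).
Hypothesis g_Nninfty : forall y, g y != -oo%E.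

Lemma objective_Nninfty y : objective f g y != -oo%E.
Proof. by move: (g_Nninfty y); rewrite /objective; case: (g y). Qed.

(** One induction shows objective and average finite: a finite average bounds the next accepted
    objective, which makes the next average finite. *)
Lemma prox_gradient_sequence_real (tau gamma_min gamma_max delta : R)
    (p : nat -> R) (x : nat -> X) :
  1 < tau -> 0 < gamma_min ->
  prox_gradient_sequence f g tau gamma_min gamma_max delta p x ->
  exists Q Phi G : nat -> R,
    [/\ forall k, objective f g (x k) = (Q k)%:E,
        Phi 0%N = Q 0%N /\
        (forall k, Phi k.+1 = (1 - p k) * Phi k + p k * Q k.+1),
        (forall k, Q k.+1 <= Phi k - delta * (G k / 2) * `|x k.+1 - x k| ^+ 2),
        (forall k, gamma_min <= G k /\
           prox_solution f g (x k) (G k) (x k.+1)) &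
        (forall k, G k <= gamma_max \/
           exists2 y, prox_solution f g (x k) (G k / tau) y &
             ~ sufficient_decrease f g delta (Phi k)%:E (G k / tau) (x k) y)].
Proof.
move=> tau1 gmin0 [dom0 [gamma0 [trial [ik run]]]].
pose Q k := fine (objective f g (x k)).
pose Phi k := fine (average_value f g p x k).
pose G k := tau ^+ ik k * gamma0 k.
have tau0 : 0 < tau by rewrite (lt_trans _ tau1).
have fin_below y (r : R) : (objective f g y <= r%:E)%E ->
    objective f g y = (fine (objective f g y))%:E.
  move=> qy; rewrite fineK// fin_numE objective_Nninfty/=.
  by apply: contraTneq qy => ->.
have accepted k : average_value f g p x k = (Phi k)%:E ->
    (objective f g (x k.+1) <=
      (Phi k - delta * (G k / 2) * `|x k.+1 - x k| ^+ 2)%:E)%E.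
  by move=> PhiE; have [_ _ _ + ->] := run k; rewrite /sufficient_decrease PhiE.
have fin k : objective f g (x k) = (Q k)%:E /\
    average_value f g p x k = (Phi k)%:E.
  elim: k => [|k [_ PhiE]].
    have Q0 : objective f g (x 0%N) = (Q 0%N)%:E.
      by rewrite fineK// fin_numE objective_Nninfty/= lt_eqF.
    by split; rewrite // /Phi /= Q0.
  have QE := fin_below _ _ (accepted k PhiE).
  by split => //; rewrite /Phi /= PhiE QE -!EFinM -EFinD.
exists Q, Phi, G; split.
- by move=> k; have [] := fin k.
- split => [|k]; first by rewrite /Phi /Q.
  by rewrite {1}/Phi /= (fin k).2 (fin k.+1).1.
- by move=> k; have := accepted k (fin k).2; rewrite (fin k.+1).1 lee_fin.
- move=> k; have [/andP[gk _] solves _ _ ->] := run k.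
  split; last exact: solves.
  have gk0 : 0 <= gamma0 k by rewrite (le_trans _ gk)// ltW.
  by rewrite (le_trans gk)// /G ler_peMl// exprn_ege1// ltW.
move=> k; have [/andP[_ gk] solves rejected _ _] := run k.
(* If the first trial is not accepted, the last rejected one has stepsize [G k / tau]. *)
case ikE : (ik k) => [|i]; first by left; rewrite /G ikE expr0 mul1r.
right; have GE : G k / tau = tau ^+ i * gamma0 k.
  by rewrite /G ikE exprS mulrC !mulrA mulVf ?mul1r// gt_eqF.
exists (trial k i); rewrite GE; first by apply: solves; rewrite ikE.
by rewrite -(fin k).2; apply: rejected; rewrite ikE.
Qed.

End run_values.

(** * Descent of the averages and vanishing steps *)

Section run.
Context {R : realType} {X : euclideanType R}.
Variables (f : X -> R) (g : X -> \bar R).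
Hypothesis f_diff : forall y, differentiable f y.
Hypothesis grad_lip : locally_lipschitz (gradient f).
Hypothesis g_Nninfty : forall y, g y != -oo%E.
Hypothesis g_lsc : lower_semicontinuous g.
Variables (tau gamma_min gamma_max delta p_min m b : R) (a : X) (p : nat -> R).
Hypothesis q_ge : forall y, (m%:E <= objective f g y)%E.
Hypothesis g_ge : forall y, (('[a, y] + b)%:E <= g y)%E.
Hypothesis tau1 : 1 < tau.
Hypothesis gamma_min0 : 0 < gamma_min.
Hypothesis delta01 : 0 < delta < 1.
Hypothesis p_min_range : 4 / 5 < p_min <= 1.
Hypothesis p_range : forall k, p_min <= p k <= 1.
Variables (x : nat -> X) (Q Phi G : nat -> R).
Hypothesis QE : forall k, objective f g (x k) = (Q k)%:E.
Hypothesis Phi0 : Phi 0%N = Q 0%N.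
Hypothesis PhiS : forall k, Phi k.+1 = (1 - p k) * Phi k + p k * Q k.+1.
Hypothesis decrease :
  forall k, Q k.+1 <= Phi k - delta * (G k / 2) * `|x k.+1 - x k| ^+ 2.
Hypothesis G_ge : forall k, gamma_min <= G k.
Hypothesis solves : forall k, prox_solution f g (x k) (G k) (x k.+1).
Hypothesis rejected : forall k, G k <= gamma_max \/
  exists2 y, prox_solution f g (x k) (G k / tau) y &
    ~ sufficient_decrease f g delta (Phi k)%:E (G k / tau) (x k) y.

Let p_le1 k : p k <= 1.
Proof. by have /andP[] := p_range k. Qed.

Lemma value_le_average k : Q k <= Phi k.
Proof.
case: k => [|k]; first by rewrite Phi0.
have Q_Phi : Q k.+1 <= Phi k.
  rewrite (le_trans (decrease k))// gerBl !mulr_ge0 ?invr_ge0 ?exprn_ge0//.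
    by have /andP[/ltW] := delta01.
  by rewrite (le_trans _ (G_ge k))// ltW.
by rewrite PhiS; have := p_le1 k; nra.
Qed.

Lemma average_decrease k :
  p_min * delta * gamma_min / 2 * `|x k.+1 - x k| ^+ 2 <= Phi k - Phi k.+1.
Proof.
have -> : Phi k - Phi k.+1 = p k * (Phi k - Q k.+1) by rewrite PhiS; ring.
have /andP[pk _] := p_range k; have /andP[d0 _] := delta01.
have pmin0 : 0 < p_min by have := p_min_range; lra.
have -> : p_min * delta * gamma_min / 2 * `|x k.+1 - x k| ^+ 2 =
    p_min * (delta * (gamma_min / 2) * `|x k.+1 - x k| ^+ 2) by ring.
apply: ler_pM => //; first exact: ltW.
  by rewrite !mulr_ge0// ltW.
rewrite lerBrDr addrC -lerBrDr (le_trans (decrease k))// lerD2l lerN2.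
by rewrite ler_wpM2r ?exprn_ge0// ler_wpM2l ?(ltW d0)// ler_wpM2r.
Qed.

Lemma average_nonincreasing k : Phi k.+1 <= Phi k.
Proof.
rewrite -subr_ge0 (le_trans _ (average_decrease k))//.
have /andP[d0 _] := delta01.
have pmin0 : 0 < p_min by have := p_min_range; lra.
by rewrite !mulr_ge0 ?exprn_ge0// ltW.
Qed.

(** The exact factor is [1 / p k - 1], and the bound [4 / 5] makes it less than a quarter. Its
    square root becomes the contraction factor 1/2 of the final recursion. *)
Lemma average_sub_value k : Phi k.+1 - Q k.+1 <= (Phi k - Phi k.+1) / 4.
Proof.
have := average_nonincreasing k; have := p_range k; have := p_min_range.
by have := PhiS k; nra.
Qed.

(** This comes from solving [average_decrease] for the step length. *)
Definition step_constant : R := Num.sqrt (2 / (p_min * delta * gamma_min)).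

Lemma step_le k :
  `|x k.+1 - x k| <= step_constant * Num.sqrt (Phi k - Phi k.+1).
Proof.
have /andP[d0 _] := delta01.
have pmin0 : 0 < p_min by have := p_min_range; lra.
have c0 : 0 < p_min * delta * gamma_min by rewrite !mulr_gt0.
rewrite /step_constant -sqrtrM ?divr_ge0 ?(ltW c0)//.
rewrite -[leLHS](ger0_norm (normr_ge0 _)) -sqrtr_sqr ler_wsqrtr//.
by rewrite mulrAC ler_pdivlMr//; have := average_decrease k; lra.
Qed.

Lemma average_is_cvg : cvgn Phi.
Proof.
apply: nonincreasing_is_cvgn.
  by apply/nonincreasing_seqP => k; exact: average_nonincreasing.
exists m => _ [k _ <-]; rewrite (le_trans _ (value_le_average k))//.
by rewrite -lee_fin -QE q_ge.
Qed.

Definition limit_value : R := limn Phi.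

Lemma limit_value_le k : limit_value <= Phi k.
Proof.
apply: nonincreasing_cvgn_ge; last exact: average_is_cvg.
by apply/nonincreasing_seqP => n; exact: average_nonincreasing.
Qed.

Lemma average_gap_cvg : (Phi k - Phi k.+1) @[k --> \oo] --> 0.
Proof.
rewrite -(subrr limit_value); apply: cvgB; first exact: average_is_cvg.
by rewrite (cvg_shiftS Phi); exact: average_is_cvg.
Qed.

Lemma sqrt_average_gap_cvg :
  Num.sqrt (Phi k - Phi k.+1) @[k --> \oo] --> 0.
Proof.
rewrite -(sqrtr0 R); apply: (cvg_comp _ _ average_gap_cvg).
exact: sqrt_continuous.
Qed.

Lemma value_cvg : Q @ \oo --> limit_value.
Proof.
have PhiS_cvg : Phi k.+1 @[k --> \oo] --> limit_value.
  by rewrite (cvg_shiftS Phi); exact: average_is_cvg.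
rewrite -(cvg_shiftS Q).
apply: (@squeeze_cvgr _ _ _ _
  (fun k => Phi k.+1 - (Phi k - Phi k.+1) / 4) (fun k => Phi k.+1)) => //.
  apply: nearW => k; rewrite value_le_average andbT.
  by rewrite /= lerBlDr -lerBlDl average_sub_value.
rewrite -[X in _ --> X]subr0 -(mul0r (4^-1 : R)).
by apply: cvgB => //; apply: cvgMl; exact: average_gap_cvg.
Qed.

Lemma step_cvg : `|x k.+1 - x k| @[k --> \oo] --> 0.
Proof.
apply: (@squeeze_cvgr _ _ _ _ (fun=> 0)
    (fun k => step_constant * Num.sqrt (Phi k - Phi k.+1))).
- by apply: nearW => k; rewrite normr_ge0 step_le.
- exact: cvg_cst.
- rewrite -[X in _ --> X](mulr0 step_constant).
  by apply: cvgMr; exact: sqrt_average_gap_cvg.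
Qed.

(** * Stepsizes and objective value at the accumulation point *)

Variable xbar : X.
Hypothesis xbar_cluster : cluster (x @ \oo) xbar.

(** This takes the place of extracting a subsequence converging to [xbar]. *)
Lemma frequently_near (P : nat -> Prop) (B : set X) :
  (\forall k \near \oo, P k) -> nbhs xbar B -> exists2 k, P k & B (x k).
Proof.
move=> oP nB; have [|_ [[k Pk <-] Bk]] := xbar_cluster (A := x @` P) _ nB.
  by apply: filterS oP => k Pk; exists k.
by exists k.
Qed.

(** Were [G k] larger than both [gamma_max] and [tau * Gamma], the rejected stepsize [G k / tau]
    would exceed [Gamma] and so be accepted. *)
Lemma stepsize_bounded_near :
  exists r M : R, [/\ 0 < r, 0 <= M & forall k, `|x k - xbar| < r -> G k <= M].
Proof.
have [r [Gamma [r0 accept]]] :=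
  large_stepsize_accepted f_diff grad_lip xbar (Phi 0%N) g_ge delta01.
have tau0 : 0 < tau by rewrite (lt_trans _ tau1).
exists r, (Num.max 0 (Num.max gamma_max (tau * Gamma))); split => //.
  by rewrite le_max lexx.
move=> k xk; rewrite !le_max; case: (rejected k) => [->|].
  by rewrite orbT.
move=> [y yP]; apply: contra_notT; rewrite !negb_or -!ltNge.
move=> /and3P[_ _ GammaG]; apply: accept yP => //.
- by rewrite ler_pdivlMr// mulrC ltW.
- by rewrite QE lee_fin value_le_average.
- by rewrite QE.
- by elim: k {xk GammaG} => // k; apply: le_trans (average_nonincreasing k).
Qed.

(** Otherwise lower semicontinuity of [g] and continuity of [f] would keep [Q k] away from its limit
    at iterates near [xbar]. *)
Lemma objective_cluster_le : (objective f g xbar <= limit_value%:E)%E.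
Proof.
suff g_le : (g xbar <= (limit_value - f xbar)%:E)%E.
  rewrite /objective; move: g_le; case: (g xbar) => [s| |] //= s_le.
    by move: s_le; rewrite -EFinD !lee_fin lerBrDl.
  by rewrite addeNy leNye.
apply/lee_addgt0Pr => e e0; rewrite -EFinD leNgt; apply/negP => lt_g.
have [V nV gV] := g_lsc lt_g.
have e2 : 0 < e / 2 by rewrite divr_gt0.
have Q_near : \forall k \near \oo, Q k < limit_value + e / 2.
  by apply: (cvgr_lt limit_value value_cvg); rewrite ltrDl.
have f_near : \forall y \near xbar, f xbar - e / 2 < f y.
  apply: (cvgr_gt (f xbar) (differentiable_continuous (f_diff xbar))).
  by rewrite gtrBl.
have [k Qk [/gV gk fk]] := frequently_near Q_near (filterI nV f_near).
move: gk; rewrite (objective_fin (QE k)) lte_fin.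
by move: fk Qk => /=; lra.
Qed.

(** Lower semicontinuity gives only one inequality. For the other, [x k.+1] is compared with [xbar]
    in the proximal problem at an [x k] near [xbar], where the bounded stepsize makes the quadratic
    term small. *)
Lemma objective_cluster : objective f g xbar = limit_value%:E.
Proof.
have := objective_cluster_le.
case qE : (objective f g xbar) => [s| |]//; last first.
  by move: (objective_Nninfty f g_Nninfty xbar); rewrite qE.
rewrite lee_fin => s_le; congr (_%:E); apply/eqP; rewrite eq_le s_le /=.
have [rM [M [rM0 M0 G_le]]] := stepsize_bounded_near.
have [r [L [r0 L0 gradL]]] := locally_lipschitz_ball xbar grad_lip.
pose B := `|gradient f xbar| + L * r.
have B0 : 0 <= B by rewrite addr_ge0// mulr_ge0// ltW.
apply/ler_addgt0Pr => e e0.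
(* One quarter each goes to the value [Q k.+1], the change of [f], the gradient term and the
   quadratic term. *)
have e4 : 0 < e / 4 by rewrite divr_gt0.
pose d := Num.min (Num.min r rM) (Num.min 1 (e / 4 / (B + M + 1))).
have BM0 : 0 < B + M + 1 by rewrite ltr_wpDl// addr_ge0.
have d0 : 0 < d by rewrite !lt_min r0 rM0 ltr01 divr_gt0.
have /nbhs_ballP[d1 /= d10 f_ball] : \forall y \near xbar, f y < f xbar + e / 4.
  apply: (cvgr_lt (f xbar) (differentiable_continuous (f_diff xbar))).
  by rewrite ltrDl.
(* Half for [x k] and half for the step, so that [x k.+1] lies in both balls. *)
pose h := Num.min d d1 / 2.
have h0 : 0 < h by rewrite divr_gt0// lt_min d0.
have step_near : \forall k \near \oo, `|x k.+1 - x k| < h.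
  exact: (cvgr_lt 0 step_cvg).
have ball_near : nbhs xbar [set y | `|y - xbar| < h].
  by apply/nbhs_ballP; exists h => //= y; rewrite -ball_normE/= distrC.
have QS_near : \forall k \near \oo, limit_value - e / 4 < Q k.+1.
  apply: (cvgr_gt limit_value); last by rewrite gtrBl.
  by rewrite (cvg_shiftS Q); exact: value_cvg.
have [k [QSk step_k] xk] :=
  frequently_near (filterI QS_near step_near) ball_near.
rewrite /= in step_k xk.
have xSk : `|x k.+1 - xbar| < Num.min d d1.
  rewrite -(subrKA (x k)) (le_lt_trans (ler_normD _ _))//.
  by rewrite [ltRHS]splitr; apply: ltrD.
have hd : h < Num.min d d1 by rewrite ltr_pdivrMr// ltr_pMr ?ltr1n// lt_min d0.
have xk' := lt_trans xk hd.
move: xSk xk'; rewrite !lt_min.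
move=> /andP[/andP[/andP[xSr xSrM] /andP[xS1 xSe]] xSd1].
move=> /andP[/andP[/andP[xr xrM] /andP[x1 xe]] xd1].
have fS : f (x k.+1) < f xbar + e / 4.
  by apply: f_ball; rewrite -ball_normE/= distrC.
have [s' ] := prox_solution_le (g_Nninfty (x k.+1)) (@solves k) qE.
rewrite QE => -[<-] {s'} step.
have grad_k : `|gradient f (x k)| <= B.
  rewrite -[gradient f _](subrK (gradient f xbar)) (le_trans (ler_normD _ _))//.
  rewrite addrC lerD2l (le_trans (gradL _ _ xr _)) ?subrr ?normr0//.
  by rewrite ler_wpM2l// ltW.
have inner_k : '[gradient f (x k), xbar - x k.+1] <= B * `|x k.+1 - xbar|.
  rewrite (le_trans (ler_norm _))// (le_trans (inner_le_norm _ _))//.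
  by rewrite distrC ler_wpM2r.
have B_small : B * `|x k.+1 - xbar| <= e / 4.
  move: xSe; rewrite ltr_pdivlMr// => /ltW; apply: le_trans.
  rewrite mulrC ler_wpM2l//; lra.
have M_small : G k / 2 * `|xbar - x k| ^+ 2 <= e / 4.
  move: xe; rewrite ltr_pdivlMr// => /ltW; apply: le_trans.
  rewrite distrC mulrC expr2 -mulrA ler_wpM2l//.
  rewrite (@le_trans _ _ (1 * (G k / 2)))//.
    by rewrite ler_wpM2r ?(ltW x1)// divr_ge0// (le_trans _ (G_ge k))// ltW.
  have := G_le k xrM; lra.
have : 0 <= G k / 2 * `|x k.+1 - x k| ^+ 2.
  by rewrite !mulr_ge0 ?exprn_ge0// (le_trans _ (G_ge k))// ltW.
move: step inner_k B_small M_small fS QSk => /=; rewrite mulrBr.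
move: '[_, _] (f _) (f _) (B * _) (G k / 2 * _) (G k / 2 * _) => *; lra.
Qed.

(** The regular subgradient from the proximal step is a limiting one through constant sequences; its
    gradient part contributes [L] and its proximal part [M]. *)
Lemma dist_subdifferential_step (r L M : R) k :
  (forall y z, `|y - xbar| < r -> `|z - xbar| < r ->
    `|gradient f y - gradient f z| <= L * `|y - z|) ->
  `|x k - xbar| < r -> `|x k.+1 - xbar| < r -> G k <= M ->
  (dist 0%R (limiting_subdifferential (objective f g) (x k.+1)) <=
    ((L + M) * `|x k.+1 - x k|)%:E)%E.
Proof.
move=> gradL xr xSr GM.
have := prox_solution_regular_subdifferential f_diff grad_lip g_Nninfty
  (@solves k) (QE k.+1).
set v := _ - _ *: _ => v_reg.
apply: ge_ereal_inf; exists `|v - 0|%:E.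
  exists v => //; split; first by rewrite /dom/= QE ltry.
  by exists (fun=> x k.+1), (fun=> v); split => //; exact: cvg_cst.
rewrite lee_fin subr0 mulrDl (le_trans (ler_normB _ _))// lerD//.
  exact: gradL.
have G0 : 0 <= G k by rewrite (le_trans _ (G_ge k))// ltW.
by rewrite normrZ (ger0_norm G0) ler_wpM2r.
Qed.

(** * Convergence under the KL property *)

Hypothesis q_KL : KL_property (objective f g) xbar.

Lemma prox_gradient_cvg : x @ \oo --> xbar.
Proof.
have [_ [eta [U [chi [eta0 nU chiP KL]]]]] := q_KL.
have [chi_cont _ chi_ge0 chi0 chi_diff] := chiP.
have [rM [M [rM0 M0 G_le]]] := stepsize_bounded_near.
have [r [L [r0 L0 gradL]]] := locally_lipschitz_ball xbar grad_lip.
have /nbhs_ballP[rU /= rU0 ballU] := nU.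
pose A k := Phi k - limit_value.
have A_ge0 k : 0 <= A k by rewrite subr_ge0 limit_value_le.
have A_gap k : A k - A k.+1 = Phi k - Phi k.+1 by rewrite /A; lra.
have AS k : A k.+1 <= A k by rewrite lerD2r average_nonincreasing.
have A_cvg : A @ \oo --> 0.
  rewrite -(subrr limit_value); apply: cvgB; first exact: average_is_cvg.
  exact: cvg_cst.
pose s k := Num.sqrt (Phi k - Phi k.+1).
pose c := step_constant.
pose C := (L + M) * c.
have c0 : 0 <= c by rewrite sqrtr_ge0.
have C0 : 0 <= C by rewrite mulr_ge0// addr_ge0.
have recursion k : `|x k - xbar| < Num.min (Num.min r rM) rU ->
    `|x k.+1 - xbar| < Num.min (Num.min r rM) rU -> A k.+1 < eta ->
    s k.+1 <= s k / 2 + C * (chi (A k.+1) - chi (A k.+2)).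
  rewrite !lt_min => /andP[/andP[xr xrM] _] /andP[/andP[xSr _] xSU] A_eta.
  have s0 : 0 <= s k by rewrite sqrtr_ge0.
  have sE : Phi k - Phi k.+1 = s k ^+ 2.
    by rewrite sqr_sqrtr// subr_ge0 average_nonincreasing.
  have chi_gap : 0 <= chi (A k.+1) - chi (A k.+2).
    by rewrite subr_ge0 (desingularizing_le chiP).
  set t := chi (A k.+1) - _ in chi_gap *.
  have rhs0 : 0 <= s k / 2 + C * t by rewrite addr_ge0// ?divr_ge0// mulr_ge0.
  (* The right-hand side is the square of [s k / 2 + C * t] without its last term. *)
  suff gap : Phi k.+1 - Phi k.+2 <= s k ^+ 2 / 4 + C * s k * t.
    rewrite -[leRHS](ger0_norm rhs0) -sqrtr_sqr ler_wsqrtr//.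
    rewrite (le_trans gap)// sqrrD exprMn.
    have : 0 <= (C * t) ^+ 2 by rewrite exprn_ge0// mulr_ge0.
    lra.
  have quarter := average_sub_value k; rewrite sE in quarter.
  have Cst : 0 <= C * s k * t by rewrite mulr_ge0// mulr_ge0.
  (* In the first case [quarter] alone suffices. In the second, [Q k.+1] exceeds [Phi k.+2] and
     hence the limit value, so the KL inequality applies at [x k.+1]. *)
  have [Q_le|Q_gt] := leP (Q k.+1) (Phi k.+2); first lra.
  pose q := Q k.+1 - limit_value.
  have q_gt : A k.+2 < q by rewrite ltrD2r.
  have q_le : q <= A k.+1 by rewrite lerD2r value_le_average.
  have q0 : 0 < q by rewrite (le_lt_trans (A_ge0 k.+2)).
  have q_eta : q < eta by rewrite (le_lt_trans q_le).
  have q_in : 0 < q < eta by rewrite q0.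
  have [_ _ dchi0] := chi_diff q q_in.
  have := KL (x k.+1); rewrite objective_cluster QE -EFinD !lte_fin /=.
  rewrite -/q => /(_ _ _)KLk.
  have {}KLk : 1 <= derive1 chi q * (C * s k).
    rewrite -lee_fin EFinM (le_trans (KLk _ _))//.
    - by apply: ballU; rewrite -ball_normE/= distrC.
    - by move: q0 q_eta; rewrite /q subr_gt0 ltrBlDl => -> ->.
    rewrite lee_wpmul2l ?lee_fin ?(ltW dchi0)//.
    rewrite (le_trans (dist_subdifferential_step gradL xr xSr (G_le k xrM)))//.
    by rewrite lee_fin /C -mulrA ler_wpM2l ?addr_ge0// step_le.
  have A2_in : 0 <= A k.+2 <= eta.
    by rewrite A_ge0 (le_trans (AS _))// ltW.
  have tangent := desingularizing_tangent chiP A2_in q_in.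
  have chi_q : chi q <= chi (A k.+1) by rewrite (desingularizing_le chiP)// ltW.
  have Q_gap : Q k.+1 - Phi k.+2 = q - A k.+2 by rewrite /q /A; lra.
  have dt : derive1 chi q * (q - A k.+2) <= t by rewrite /t; lra.
  (* Multiplying [q - A k.+2] by the KL product, which is at least 1, brings in the slope that [dt]
     bounds. *)
  have : q - A k.+2 <= C * s k * t.
    have q_gap0 : 0 <= q - A k.+2 by rewrite subr_ge0 ltW.
    rewrite (le_trans (ler_peMl q_gap0 KLk))// mulrAC mulrC.
    by rewrite ler_wpM2l// mulr_ge0.
  lra.
have phi_cvg : chi (A k.+1) @[k --> \oo] --> 0.
  apply: (desingularizing_cvg0 chiP (u := fun k => A k.+1)) => //.
  by rewrite (cvg_shiftS A).
have s_cvg : s @ \oo --> 0 by exact: sqrt_average_gap_cvg.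
apply/cvgrPdist_lt => e e0.
(* The target radius is capped by the radii on which the gradient, stepsize and KL bounds hold. *)
pose e' := Num.min e (Num.min (Num.min r rM) rU).
have e'0 : 0 < e' by rewrite !lt_min e0 r0 rM0.
have V_cvg : (2 * c * s k + 2 * c * C * chi (A k.+1)) @[k --> \oo] --> 0.
  rewrite -[X in _ --> X]addr0; apply: cvgD.
    by rewrite -[X in _ --> X](mulr0 (2 * c)); exact: cvgMr.
  by rewrite -[X in _ --> X](mulr0 (2 * c * C)); exact: cvgMr.
have e'2 : 0 < e' / 2 by rewrite divr_gt0.
have V_near : \forall k \near \oo,
    2 * c * s k + 2 * c * C * chi (A k.+1) < e' / 2.
  exact: (cvgr_lt 0 V_cvg).
have [N _ A_eta] : \forall k \near \oo, A k < eta.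
  exact: (cvgr_lt 0 A_cvg).
have N_near : \forall k \near \oo, (N <= k)%N by exists N.
have ball_near : nbhs xbar [set y | `|y - xbar| < e' / 2].
  by apply/nbhs_ballP; exists (e' / 2) => //= y; rewrite -ball_normE/= distrC.
(* At [K] the distance to [xbar] and the rest of the potential are each below [e' / 2]. *)
have [K [VK NK] xK] := frequently_near (filterI V_near N_near) ball_near.
exists K => // k /= Kk; rewrite distrC.
have AK j : (K <= j)%N -> A j < eta.
  by move=> Kj; apply: A_eta; exact: leq_trans Kj.
suff : `|x k - xbar| < e' by rewrite lt_min => /andP[].
apply: (@trapped_in_ball _ _ x xbar s (chi \o A) c C e' K) => //=.
- by move=> j; rewrite sqrtr_ge0.
- by move=> j Kj; apply: chi_ge0; rewrite in_itv/= A_ge0 ltW// AK.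
- by move=> j; exact: step_le.
- move=> j Kj; rewrite !(lt_min _ e) => /andP[_ xj] /andP[_ xSj].
  by apply: recursion => //; apply: AK; rewrite leqW.
- by rewrite [ltRHS]splitr -addrA; apply: ltrD.
Qed.

End run.

Theorem theorem3p8 (R : realType) (X : euclideanType R)
    (f : X -> R) (g : X -> \bar R)
    (tau gamma_min gamma_max delta p_min : R) (p : nat -> R)
    (x : nat -> X) (xbar : X)
    (f_C1 : continuously_differentiable f)
    (g_Nninfty : forall y, g y != -oo%E)
    (g_lsc : lower_semicontinuous g)
    (q_bounded_below :
      exists m : R, forall y, dom g y -> (m%:E <= objective f g y)%E)
    (g_affine_minorant :
      exists (a : X) (b : R), forall y, (('[a, y] + b)%:E <= g y)%E)
    (grad_lipschitz : locally_lipschitz (gradient f))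
    (tau_gt1 : 1 < tau)
    (gamma_min_gt0 : 0 < gamma_min)
    (gamma_min_max : gamma_min <= gamma_max)
    (delta01 : 0 < delta < 1)
    (p_min_range : 4 / 5 < p_min <= 1)
    (p_range : forall k, p_min <= p k <= 1)
    (x_generated :
      prox_gradient_sequence f g tau gamma_min gamma_max delta p x)
    (xbar_accumulation : cluster (x @ \oo) xbar)
    (q_KL : KL_property (objective f g) xbar) :
  x @ \oo --> xbar.
Proof.
have [f_diff _] := f_C1.
have [m q_ge] := q_bounded_below.
have [a [b g_ge]] := g_affine_minorant.
(* Outside [dom g] the objective is [+oo], so the bound extends to all points. *)
have q_ge' y : (m%:E <= objective f g y)%E.
  have [gy|] := ltP (g y) +oo%E; first exact: q_ge.
  by rewrite leye_eq /objective => /eqP ->; rewrite leey.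
have [Q [Phi [G [QE [Phi0 PhiS] decrease G_solves rejected]]]] :=
  prox_gradient_sequence_real g_Nninfty tau_gt1 gamma_min_gt0 x_generated.
have G_ge k := (G_solves k).1.
have solves k := (G_solves k).2.
exact: (prox_gradient_cvg f_diff grad_lipschitz g_Nninfty g_lsc q_ge' g_ge
  tau_gt1 gamma_min_gt0 delta01 p_min_range p_range QE Phi0 PhiS decrease G_ge
  solves rejected xbar_accumulation q_KL).
Qed.
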